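(* Let $G$ be a discrete group. If for every $g\in G$ the set $R_g=\{x\in G\mid x^n=g\text{ for some }n\in\mathbb{N}\}$ of roots of $g$ is finite, then $\mathrm{Sub}^c_G$ is closed in $\mathrm{Sub}_G$. In particular, if $G$ is a strongly root compact discrete group, then $\mathrm{Sub}^c_G$ is closed in $\mathrm{Sub}_G$.
   Context: $\mathbb{N}=\{1,2,\dots\}$. $\mathrm{Sub}_G$ is the compact space of all closed subgroups of $G$ with the Chabauty topology: a sub-basis is given by the sets $\{A\in\mathrm{Sub}_G\mid A\cap K=\emptyset\}$ ($K\subset G$ compact) and $\{A\in\mathrm{Sub}_G\mid A\cap U\ne\emptyset\}$ ($U\subset G$ open). $\mathrm{Sub}^c_G$ is the set of all closed cyclic subgroups of $G$ (for discrete $G$, all cyclic subgroups). A locally compact group $G$ with identity $e$ is strongly root compact if for every compact $C\subset G$ there is a compact $C_0\subset G$ such that for every $n\in\mathbb{N}$, every finite sequence $\{x_1,\dots,x_n\}$ in $G$ with $x_n=e$ satisfying $Cx_iCx_j\cap Cx_{i+j}\neq\emptyset$ for all $i+j\le n$ is contained in $C_0$. *)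

(* Defs.v *)
From HB Require Import structures.
From mathcomp Require Import all_boot.
From mathcomp Require Import all_classical.
From mathcomp Require Import topology.

Set Implicit Arguments.
Unset Strict Implicit.
Unset Printing Implicit Defensive.

Local Open Scope classical_set_scope.
Local Open Scope group_scope.

HB.mixin Record isTopologicalGroup G & Topological G & Group G := {
  mulg_continuous : continuous (fun xy : G * G => xy.1 * xy.2);
  invg_continuous : continuous (fun x : G => x^-1);
}.

#[short(type="topologicalGroupType")]
HB.structure Definition TopologicalGroup :=
  {G of Topological G & Group G & isTopologicalGroup G}.

#[short(type="discreteGroupType")]
HB.structure Definition DiscreteGroup :=
  {G of TopologicalGroup G & Discrete_ofNbhs G}.

(* Every abstract group is a discrete topological group. *)
Section DiscreteTopologyGroup.
Variable G : groupType.
Local Notation dG := (discrete_topology G).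

HB.instance Definition _ := Group.copy dG G.

Let mul_cts : continuous (fun xy : dG * dG => xy.1 * xy.2).
Proof.
move=> [x y] A /= /principal_filterP Axy.
exists ([set x], [set y]); first by split; exact: discrete_set1.
by move=> [_ _] [/= -> ->].
Qed.

Let inv_cts : continuous (fun x : dG => x^-1).
Proof.
move=> x A /= /principal_filterP Ax.
by apply/principal_filterP.
Qed.

HB.instance Definition _ := isTopologicalGroup.Build dG mul_cts inv_cts.

End DiscreteTopologyGroup.

Definition closed_subgroups (G : topologicalGroupType) : set (set G) :=
  [set H | group_closed [in H] /\ closed H].
Arguments closed_subgroups G : clear implicits.

Definition SubG (G : topologicalGroupType) : Type :=
  set_type (closed_subgroups G).

HB.instance Definition _ (G : topologicalGroupType) :=
  SubChoice.copy (SubG G) (set_type (closed_subgroups G)).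

Section Chabauty.
Variable G : topologicalGroupType.

Definition chabauty_miss (K : set G) : set (SubG G) :=
  [set A | val A `&` K = set0].

Definition chabauty_hit (U : set G) : set (SubG G) :=
  [set A | val A `&` U !=set0].

Definition chabauty_subbase : set (set (SubG G)) :=
  [set chabauty_miss K | K in compact] `|`
  [set chabauty_hit U | U in open].

HB.instance Definition _ :=
  isSubBaseTopological.Build (SubG G) chabauty_subbase id.

End Chabauty.

Definition cyclic_subgroup (G : groupType) (g : G) : set G :=
  [set x | exists n : nat, x = g ^+ n \/ x = g ^- n].

Definition SubG_cyclic (G : topologicalGroupType) : set (SubG G) :=
  [set A | exists g : G, val A = cyclic_subgroup g].
Arguments SubG_cyclic G : clear implicits.

Definition root_set (G : groupType) (g : G) : set G :=
  [set x | exists2 n : nat, (0 < n)%N & x ^+ n = g].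

Definition set_rmul (G : groupType) (A : set G) (x : G) : set G :=
  [set a * x | a in A].

Definition set_mul (G : groupType) (A B : set G) : set G :=
  [set a * b | a in A & b in B].

(* The finite sequence x_1, ..., x_n is encoded by a function on nat of which
   only the values at 1, ..., n are used. *)
Definition strongly_root_compact (G : topologicalGroupType) : Prop :=
  forall C : set G, compact C ->
  exists2 C0 : set G, compact C0 &
    forall (n : nat) (x : nat -> G), (0 < n)%N -> x n = 1 ->
      (forall i j : nat, (0 < i)%N -> (0 < j)%N -> (i + j <= n)%N ->
         set_mul (set_rmul C (x i)) (set_rmul C (x j))
           `&` set_rmul C (x (i + j)%N) !=set0) ->
      forall i : nat, (0 < i <= n)%N -> C0 (x i).

(* Main.v *)
(* A nontrivial closed subgroup A contains some g <> 1, and the subgroups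
   containing g form a neighbourhood of A.  The cyclic ones among them are
   generated by roots of g, hence are finitely many when R_g is finite; as
   Sub_G is T1, A is one of them if it is a limit of cyclic subgroups.
   Strong root compactness bounds R_g: apply it to C = {1, g} and to the
   sequence x, x^2, ..., x^(n-1), 1, where x^n = g. *)
Require Import Defs.
From mathcomp Require Import all_boot.
From mathcomp Require Import all_classical.
From mathcomp Require Import topology.

Local Open Scope classical_set_scope.
Local Open Scope group_scope.

(** If [A] were infinite, the sets containing all but finitely many points of [A] would form a
    proper filter. It has no cluster point [p], since it contains the complement of the
    neighbourhood [[set p]]. *)
Lemma discrete_compact_finite (T : discreteTopologicalType) (A : set T) :
  compact A -> finite_set A.
Proof.
move=> cA; apply: contrapT => infA.
pose F : set_system T := [set B | finite_set (A `\` B)].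
have FF : ProperFilter F.
  split; first by rewrite /F /= setD0.
  split=> [|B C FB FC|B C BC].
  - by rewrite /F /= setDT.
  - by rewrite /F /= setDIr finite_setU.
  - by apply: sub_finite_set; exact: setDS.
have FA : F A by rewrite /F /= setDv.
have [p [_ /(_ (~` [set p]) [set p])]] := cA F FF FA.
case=> [||q [] //].
- by rewrite /F /= setDE setCK; apply/finite_setIr/finite_set1.
- exact: discrete_set1.
Qed.

Lemma chabauty_subbase_open (G : topologicalGroupType) (U : set (SubG G)) :
  @chabauty_subbase G U -> open U.
Proof.
move=> sU; exists [set U]; last by rewrite bigcup_set1.
by move=> _ ->; exact: (@finI_from1 _ _ _ id).
Qed.

Lemma chabauty_hit_open (G : topologicalGroupType) (U : set G) :
  open U -> open (chabauty_hit U).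
Proof. by move=> oU; apply: chabauty_subbase_open; right; exists U. Qed.

Lemma chabauty_miss_open (G : topologicalGroupType) (K : set G) :
  compact K -> open (chabauty_miss K).
Proof. by move=> cK; apply: chabauty_subbase_open; left; exists K. Qed.

(** A point [b] of [B] outside [A] separates by missing the compact set [[set b]]; a point of [A]
    outside [B] separates by hitting the complement of [B], open because [B] is closed. *)
Lemma SubG_accessible (G : topologicalGroupType) : accessible_space (SubG G).
Proof.
move=> A B /eqP neqAB.
have [AB|/existsNP[a /not_implyP[Aa nBa]]] := pselect (val A `<=` val B).
- have /existsNP[b /not_implyP[Bb nAb]] : ~ (val B `<=` val A).
    by move=> BA; apply: neqAB; apply: val_inj; apply/seteqP.
  exists (chabauty_miss [set b]); split.
  + exact/chabauty_miss_open/compact_set1.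
  + by rewrite inE; apply/seteqP; split=> // x [Ax xb]; apply: nAb; rewrite -xb.
  + by rewrite inE => BK; have : (val B `&` [set b]) b by []; rewrite BK.
- have /set_mem[_ cB] := valP B.
  exists (chabauty_hit (~` val B)); split.
  + exact/chabauty_hit_open/closed_openC.
  + by rewrite inE; exists a.
  + by rewrite inE => -[x []].
Qed.

Lemma cyclic_subgroupV (G : groupType) (g : G) :
  cyclic_subgroup g^-1 = cyclic_subgroup g.
Proof.
apply/seteqP; split=> x [n xn]; exists n; move: xn;
  by rewrite expVgn ?invgK => -[]; [right|left].
Qed.

(** As [g] is not 1, it is a nonzero power of [h]; if the exponent is negative, the generator [h^-1]
    is the root. *)
Lemma cyclic_subgroup_root (G : groupType) (g h : G) :
  g <> 1 -> cyclic_subgroup h g ->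
  exists2 r, root_set g r & cyclic_subgroup h = cyclic_subgroup r.
Proof.
move=> g1 [[|n] [] gE]; rewrite gE ?expg0 ?invg1 // in g1 *.
- by exists h => //; exists n.+1.
- exists h^-1; last by rewrite cyclic_subgroupV.
  by exists n.+1; rewrite ?expVgn.
Qed.

Lemma finite_cyclic_of_generators (G : topologicalGroupType) (R : set G) :
  finite_set R ->
  finite_set [set A : SubG G | exists2 r, R r & val A = cyclic_subgroup r].
Proof.
move=> finR.
have := finite_preimage (f := val : SubG G -> set G) (in2W val_inj)
  (finite_image (@cyclic_subgroup G) finR).
by apply: sub_finite_set => A [r Rr Ar]; exists r.
Qed.

Lemma closed_SubG_cyclic (G : discreteGroupType) :
  (forall g : G, finite_set (root_set g)) -> closed (SubG_cyclic G).
Proof.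
move=> finR A clA.
have /set_mem[[A1 _] _] := valP A.
(* The trivial subgroup is cyclic; it is set apart because containing 1 puts no constraint on a
   generator. *)
have [A_sub1|/existsNP[g /not_implyP[Ag g1]]] := pselect (val A `<=` [set 1]).
  exists 1; apply/seteqP; split=> x.
    by move=> /A_sub1 ->; exists 0%N; left.
  by move=> [n]; rewrite expg1n invg1 => -[] ->; rewrite inE in A1.
have /accessible_finite_set_closed clF := @SubG_accessible G.
have [|r _ Ar] := clF _ (finite_cyclic_of_generators _ _ (finR g)) A; last first.
  by exists r.
move=> U AU.
(* Shrinking [U] by this open condition forces the cyclic subgroup [B] found near [A] to contain
   [g]. *)
have [|B [[h Bh] [[x [Bx xg]] UB]]] := clA (chabauty_hit [set g] `&` U).
  apply: filterI => //; apply: open_nbhs_nbhs; split.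
    exact/chabauty_hit_open/discrete_open.
  by exists g.
exists B; split=> //.
have [|r Rr hr] := @cyclic_subgroup_root G g h g1; first by rewrite -Bh -xg.
by exists r; rewrite // Bh.
Qed.

Lemma strongly_root_compact_finite_roots (G : discreteGroupType) (g : G) :
  strongly_root_compact G -> finite_set (root_set g).
Proof.
move=> srcG.
have [|C0 /discrete_compact_finite finC0 rootC0] := srcG [set 1; g].
  by apply: finite_compact; rewrite finite_setU; split; exact: finite_set1.
(* The point [g] is added for the exponent 1, where the sequence reduces to the single term 1 and
   says nothing about [x]. *)
apply: (@sub_finite_set _ _ (C0 `|` [set g])); last first.
  by rewrite finite_setU; split=> //; exact: finite_set1.
move=> x [[|[|n]] // _ xg]; first by right; rewrite /= -xg expg1.
left; pose s i := if (i < n.+2)%N then x ^+ i else 1.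
have -> : x = s 1%N by rewrite /s expg1.
apply: (rootC0 n.+2) => //; first by rewrite /s ltnn.
move=> i j i0 j0 ijn.
have sE k l : (0 < l)%N -> (k + l <= n.+2)%N -> s k = x ^+ k.
  move=> l0 kln; rewrite /s ifT//; apply: leq_trans kln.
  by rewrite -addn1 leq_add2l.
have C1 k : set_rmul [set 1; g] (s k) (s k).
  by exists 1; [left|rewrite mul1g].
exists (x ^+ (i + j)); split.
  exists (s i) => //; exists (s j) => //.
  by rewrite (sE i j) // (sE j i) ?expgnDr // addnC.
have [ijlt|ijge] := ltnP (i + j) n.+2.
  by have := C1 (i + j)%N; rewrite {2}/s ijlt.
(* Here [i + j = n.+2]: the last term is 1 instead of [g], and the element [g] of the compact set
   makes up for it. *)
exists g; first by right.
have /eqP -> : (i + j)%N == n.+2 by rewrite eqn_leq ijn.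
by rewrite /s ltnn mulg1.
Qed.

Theorem lemma3p4 (G : discreteGroupType) :
  ((forall g : G, finite_set (root_set g)) -> closed (SubG_cyclic G)) /\
  (strongly_root_compact G -> closed (SubG_cyclic G)).
Proof.
split; first exact: closed_SubG_cyclic.
move=> srcG; apply: closed_SubG_cyclic => g.
exact: strongly_root_compact_finite_roots.
Qed.
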